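(* Let $n > 3$ be an integer. Then $\partial \Theta_n \subseteq E_n$; that is, every boundary point $\lambda$ of $\Theta_n$ belongs to $\Theta_n$ and satisfies $\gamma \lambda \notin \Theta_n$ for all real $\gamma > 1$.
   Context: A stochastic matrix is an entrywise nonnegative real square matrix each of whose rows sums to one. $\Theta_n \subseteq \mathbb{C}$ denotes the set of all eigenvalues of all $n \times n$ stochastic matrices, and $\partial \Theta_n$ is its topological boundary in $\mathbb{C}$. A number $\lambda \in \Theta_n$ is called extremal if $\gamma \lambda \notin \Theta_n$ for all real $\gamma > 1$; $E_n$ denotes the set of extremal numbers of $\Theta_n$. *)

(* Defs.v *)
From HB Require Import structures.
From mathcomp Require Import all_boot all_order all_algebra.
From mathcomp Require Import boolp classical_sets reals topology normedtype.
From mathcomp Require Import complex.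

Set Implicit Arguments.
Unset Strict Implicit.
Unset Printing Implicit Defensive.

Import Order.TTheory GRing.Theory Num.Theory.
Import numFieldNormedType.Exports.

Local Open Scope classical_set_scope.
Local Open Scope ring_scope.
Local Open Scope complex_scope.

Definition boundary (T : topologicalType) (A : set T) : set T :=
  closure A `\` interior A.

Definition stochastic (R : realType) (n : nat) (A : 'M[R]_n) : Prop :=
  (forall i j, 0 <= A i j) /\ (forall i, \sum_j A i j = 1).

(* [R[i]^o] is [R[i]] as a normed module over itself, whose topology is that of
   the modulus. The library's [eigenvalue] is about row vectors, [v *m A = l *: v];
   a square matrix has the same left and right eigenvalues. *)
Definition Theta (R : realType) (n : nat) : set R[i]^o :=
  [set l | exists A : 'M[R]_n,
     stochastic A /\ eigenvalue (map_mx (real_complex R) A) l].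
Arguments Theta : clear implicits.

Definition extremal (R : realType) (n : nat) : set R[i]^o :=
  [set l | Theta R n l /\
           forall gamma : R, 1 < gamma -> ~ Theta R n (gamma%:C * l)].
Arguments extremal : clear implicits.

(* Main.v *)
(* If mu is in Theta_n, every t mu with 0 < t < 1 turns out to be interior to
   Theta_n; as Theta_n is closed, this is the theorem.
   For mu nonreal, let v be a left eigenvector of the stochastic matrix A.
   Then v is orthogonal to the all-ones vector, so it is a left eigenvector of
   the positive stochastic matrix B = t A + (1 - t) J / n for t mu. The real and
   imaginary parts of v are linearly independent, so every small complex d
   admits a small real E with v E = d v and zero row sums, and B + E is a
   stochastic matrix with eigenvalue t mu + d.
   For mu real, t mu lies in (-1, 1), which is interior to the square with
   vertices 1, i, -1, -i; circulant matrices of order 4 realize this square. *)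
Require Import Defs.
From mathcomp Require Import all_boot all_order all_algebra.
From mathcomp Require Import boolp classical_sets reals topology normedtype.
From mathcomp Require Import complex.
From mathcomp Require Import ring lra.

Import numFieldNormedType.Exports.

Local Open Scope classical_set_scope.

Set Implicit Arguments.
Unset Strict Implicit.
Unset Printing Implicit Defensive.

Import Order.TTheory GRing.Theory Num.Theory.
Local Open Scope ring_scope.
Local Open Scope complex_scope.

(** * Eigenvalues in terms of real row vectors *)

(* [p + i q] is a left eigenvector of [A] for [a + i b]. *)
Definition eigenpair (R : realType) n (A : 'M[R]_n) (a b : R) (p q : 'rV[R]_n) :=
  p *m A = a *: p - b *: q /\ q *m A = b *: p + a *: q.

Lemma ThetaP (R : realType) n (a b : R) :
  Theta R n (a +i* b) <->
  exists (A : 'M[R]_n) (p q : 'rV[R]_n),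
    [/\ stochastic A, (p != 0) || (q != 0) & eigenpair A a b p q].
Proof.
split=> [[A [sA /eigenvalueP[v vA v0]]]|[A [p [q [sA pq0 [pA qA]]]]]].
  exists A, (\row_j complex.Re (v ord0 j)), (\row_j complex.Im (v ord0 j)); split=> //.
    rewrite -negb_and; apply: contra v0 => /andP[/eqP p0 /eqP q0].
    apply/eqP/rowP => j; move/rowP/(_ j): p0; move/rowP/(_ j): q0.
    by rewrite !mxE; case: (v _ _) => x y /= -> ->.
  split; apply/rowP => j; move/rowP/(_ j): vA; rewrite !mxE => vA.
    have -> : \sum_k (\row_j complex.Re (v ord0 j)) ord0 k * A k j
      = complex.Re (\sum_k v ord0 k * (map_mx (real_complex R) A) k j).
      rewrite (raddf_sum (@complex.Re R : {additive Rcomplex R -> R})) /=.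
      by apply: eq_bigr => k _; rewrite !mxE; case: (v _ _) => x y /=; ring.
    by rewrite vA; case: (v _ _).
  have -> : \sum_k (\row_j complex.Im (v ord0 j)) ord0 k * A k j
      = complex.Im (\sum_k v ord0 k * (map_mx (real_complex R) A) k j).
      rewrite (raddf_sum (@complex.Im R : {additive Rcomplex R -> R})) /=.
      by apply: eq_bigr => k _; rewrite !mxE; case: (v _ _) => x y /=; ring.
  by rewrite vA; case: (v _ _) => x y /=; ring.
exists A; split=> //; apply/eigenvalueP.
exists (\row_j (p ord0 j +i* q ord0 j)).
  apply/rowP => j; move/rowP/(_ j): pA; move/rowP/(_ j): qA; rewrite !mxE.
  move=> qA pA; apply/eqP; rewrite eq_complex.
  rewrite (raddf_sum (@complex.Re R : {additive Rcomplex R -> R})).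
  rewrite (raddf_sum (@complex.Im R : {additive Rcomplex R -> R})) /=.
  apply/andP; split; apply/eqP; [rewrite -pA | rewrite addrC -qA].
    by apply: eq_bigr => k _; rewrite !mxE /=; ring.
  by apply: eq_bigr => k _; rewrite !mxE /=; ring.
apply: contraTN pq0 => /eqP /rowP v0; rewrite -negb_and negbK.
by apply/andP; split; apply/eqP/rowP => j; move: (v0 j); rewrite !mxE => -[].
Qed.

(** * Interior and closure in real coordinates *)

Lemma nbhs_Theta (R : realType) n (a b e : R) : 0 < e ->
  (forall x y, `|x - a| < e -> `|y - b| < e -> Theta R n (x +i* y)) ->
  interior (Theta R n) (a +i* b).
Proof.
move=> e0 H; apply/nbhs_ballP; exists e%:C; first by rewrite /= ltcR.
move=> [x y] /=; rewrite /ball /= => xy.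
apply: H; rewrite -ltcR; apply: le_lt_trans xy; rewrite distrC normc_def /= lecR.
  rewrite -sqrtr_sqr; apply: ler_wsqrtr; rewrite lerDl; exact: sqr_ge0.
rewrite -sqrtr_sqr; apply: ler_wsqrtr; rewrite lerDr; exact: sqr_ge0.
Qed.

(** The squared distance is the form that matches the value of [defect] computed in
    [defect_shift]. *)
Lemma closure_Theta (R : realType) n (a b e : R) :
  closure (Theta R n) (a +i* b) -> 0 < e ->
  exists x y, Theta R n (x +i* y) /\ (x - a) ^+ 2 + (y - b) ^+ 2 < e.
Proof.
move=> cl e0.
have [[x y] [Txy]] := cl _ (nbhsx_ballx (a +i* b : R[i]^o) (Num.sqrt e)%:C
   ltac:(rewrite ltcR sqrtr_gt0; exact e0)).
rewrite /ball /= normc_def ltcR => H; exists x, y; split=> //.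
have h0 : 0 <= (x - a) ^+ 2 + (y - b) ^+ 2 by rewrite addr_ge0 ?sqr_ge0.
move: H; rewrite /= ltr_sqrt //; congr (_ < _); ring.
Qed.

(** * Closedness, by compactness of a box of matrices and vectors *)

(* Coordinates of a triple [(A, p, q)] of a matrix and two row vectors. *)
Definition state (n : nat) : Type := ('I_n * 'I_n + ('I_n + 'I_n))%type.

Section Closed.
Variables (R : realType) (n : nat).
Implicit Type g : {ptws (state n) -> R}.

Definition mxpart g : 'M[R]_n := \matrix_(i, j) g (inl (i, j)).
Definition repart g : 'rV[R]_n := \row_j g (inr (inl j)).
Definition impart g : 'rV[R]_n := \row_j g (inr (inr j)).

(* Sum of the squared violations of: the rows of [A] sum to 1, [p + i q] has
   norm 1, and it is a left eigenvector of [A] for [a + i b]. Thus [Theta R n]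
   is the set of [a + i b] for which it vanishes somewhere on a compact box. *)
Definition defect (a b : R) g : R :=
  \sum_i (\sum_j g (inl (i, j)) - 1) ^+ 2 +
  (\sum_(k : 'I_n + 'I_n) g (inr k) ^+ 2 - 1) ^+ 2 +
  \sum_j (\sum_i g (inr (inl i)) * g (inl (i, j))
          - (a * g (inr (inl j)) - b * g (inr (inr j)))) ^+ 2 +
  \sum_j (\sum_i g (inr (inr i)) * g (inl (i, j))
          - (b * g (inr (inl j)) + a * g (inr (inr j)))) ^+ 2.

(** Entries of a stochastic matrix lie in [0, 1] and coordinates of a unit vector in [-1, 1].
    Nonnegativity of the matrix is imposed here and not by [defect]. In the pointwise topology [box]
    is a product of segments, so Tychonoff applies. *)
Definition side (x : state n) : set R :=
  if x is inl _ then `[0, 1]%classic else `[-1, 1]%classic.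

Definition box : set {ptws (state n) -> R} := [set g | forall x, side x (g x)].

Lemma box_compact : compact box.
Proof.
apply: (@tychonoff (state n) (fun _ => R) side) => -[x|x] /=;
  exact: segment_compact.
Qed.

Lemma defect_continuous a b : continuous (defect a b).
Proof.
pose T := {ptws (state n) -> R}.
have proj_cont x : continuous (fun g : T => g x : R).
  exact: (@proj_continuous (state n) (fun _ => R) x).
have cst_cont (c : R) : continuous (fun _ : T => c).
  exact: cst_continuous.
have add_cont (h k : T -> R) : continuous h -> continuous k ->
    continuous (fun g => h g + k g).
  by move=> hc kc g; exact: (continuousD (hc g) (kc g)).
have sub_cont (h k : T -> R) : continuous h -> continuous k ->
    continuous (fun g => h g - k g).
  by move=> hc kc g; exact: (continuousB (hc g) (kc g)).
have mul_cont (h k : T -> R) : continuous h -> continuous k ->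
    continuous (fun g => h g * k g).
  by move=> hc kc g; exact: (continuousM (hc g) (kc g)).
have sqr_cont (h : T -> R) : continuous h -> continuous (fun g => h g ^+ 2).
  by move=> hc; exact: (mul_cont h h hc hc).
have sum_cont (I : finType) (h : I -> T -> R) :
    (forall i, continuous (h i)) -> continuous (fun g => \sum_i h i g).
  by move=> hc; apply: continuous_big => //; exact: add_continuous.
have lin_cont c x : continuous (fun g : T => c * g x).
  by apply: (mul_cont (fun=> c) (fun g => g x)).
have prod_cont x y : continuous (fun g : T => g x * g y).
  by apply: (mul_cont (fun g => g x) (fun g => g y)).
apply/add_cont; first apply/add_cont; first apply/add_cont.
- apply/sum_cont => i; apply/sqr_cont; apply/sub_cont => //.
  by apply/sum_cont.
- apply/sqr_cont; apply/sub_cont => //.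
  by apply/sum_cont => k; exact: sqr_cont.
- apply/sum_cont => j; apply/sqr_cont; apply/sub_cont; last exact: sub_cont.
  by apply/sum_cont.
- apply/sum_cont => j; apply/sqr_cont; apply/sub_cont; last exact: add_cont.
  by apply/sum_cont.
Qed.

Lemma defect_eq0 a b g : defect a b g = 0 <->
  [/\ forall i, \sum_j g (inl (i, j)) = 1,
      \sum_(k : 'I_n + 'I_n) g (inr k) ^+ 2 = 1 &
      eigenpair (mxpart g) a b (repart g) (impart g)].
Proof.
have ssq (I : finType) (F : I -> R) : 0 <= \sum_i F i ^+ 2.
  by apply: sumr_ge0 => i _; exact: sqr_ge0.
have ssq0 (I : finType) (F : I -> R) : \sum_i F i ^+ 2 = 0 -> forall i, F i = 0.
  move=> /psumr_eq0P F0 i; apply/eqP; rewrite -sqrf_eq0; apply/eqP.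
  by apply: F0 => // k _; exact: sqr_ge0.
rewrite /defect; split.
  move/eqP; rewrite !paddr_eq0 ?addr_ge0 ?ssq ?sqr_ge0 //.
  move=> /andP[/andP[/andP[/eqP/ssq0 s1 s2] /eqP/ssq0 s3] /eqP/ssq0 s4].
  split.
  - by move=> i; apply/eqP; rewrite -subr_eq0 s1.
  - by apply/eqP; rewrite -subr_eq0 -sqrf_eq0.
  - split; apply/rowP => j.
      move/eqP: (s3 j); rewrite subr_eq0 => /eqP; rewrite !mxE => <-.
      by apply: eq_bigr => k _; rewrite !mxE.
    move/eqP: (s4 j); rewrite subr_eq0 => /eqP; rewrite !mxE => <-.
    by apply: eq_bigr => k _; rewrite !mxE.
case=> s1 s2 [s3 s4].
rewrite s2 subrr expr0n /= addr0.
rewrite !big1 ?addr0 // => [j _|j _|i _]; apply/eqP; rewrite sqrf_eq0 subr_eq0.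
- move/rowP/(_ j): s4; rewrite !mxE => <-; apply/eqP.
  by apply: eq_bigr => k _; rewrite !mxE.
- move/rowP/(_ j): s3; rewrite !mxE => <-; apply/eqP.
  by apply: eq_bigr => k _; rewrite !mxE.
- by rewrite s1.
Qed.

(** If v A = (x + i y) v, then v A - (a + i b) v is v times the difference of the two numbers. As v
    has norm 1, the squared norm of this residual is the squared distance. *)
Lemma defect_shift a b x y g : defect x y g = 0 ->
  defect a b g = (x - a) ^+ 2 + (y - b) ^+ 2.
Proof.
move=> /defect_eq0[s1 s2 [s3 s4]].
rewrite /defect s2 subrr expr0n /= addr0 big1 ?add0r; last first.
  by move=> i _; rewrite s1 subrr expr0n.
rewrite -big_split /= -[RHS]mulr1 -s2 big_sumType /= -big_split /= mulr_sumr.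
apply: eq_bigr => j _.
have -> : \sum_i g (inr (inl i)) * g (inl (i, j))
          = x * g (inr (inl j)) - y * g (inr (inr j)).
  move/rowP/(_ j): s3; rewrite !mxE => <-.
  by apply: eq_bigr => k _; rewrite !mxE.
have -> : \sum_i g (inr (inr i)) * g (inl (i, j))
          = y * g (inr (inl j)) + x * g (inr (inr j)).
  move/rowP/(_ j): s4; rewrite !mxE => <-.
  by apply: eq_bigr => k _; rewrite !mxE.
ring.
Qed.

(** Dividing the eigenvector by its norm [r] brings it into the box. Conversely, norm 1 keeps the
    vector of a zero of [defect] from vanishing. *)
Lemma defectP a b :
  Theta R n (a +i* b) <-> exists2 g, box g & defect a b g = 0.
Proof.
split=> [/ThetaP[A [p [q [[A0 A1] pq0 [pA qA]]]]]|[g bg /defect_eq0[s1 s2 s3]]].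
  pose s := \sum_j p ord0 j ^+ 2 + \sum_j q ord0 j ^+ 2.
  have ssq (u : 'rV[R]_n) : 0 <= \sum_j u ord0 j ^+ 2.
    by apply: sumr_ge0 => i _; exact: sqr_ge0.
  have ssq_gt0 (u : 'rV[R]_n) : u != 0 -> 0 < \sum_j u ord0 j ^+ 2.
    rewrite lt_def ssq andbT; apply: contraNN => /eqP /psumr_eq0P u0.
    apply/eqP/rowP => j; rewrite !mxE; apply/eqP; rewrite -sqrf_eq0; apply/eqP.
    by apply: u0 => // k _; exact: sqr_ge0.
  have s0 : 0 < s.
    by case/orP: pq0 => /ssq_gt0 ?; [rewrite ltr_pwDl | rewrite ltr_wpDl].
  pose r := Num.sqrt s.
  have r0 : 0 < r by rewrite sqrtr_gt0.
  have r2 : r ^+ 2 = s by rewrite sqr_sqrtr // ltW.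
  pose g : {ptws (state n) -> R} := fun x => match x with
    | inl (i, j) => A i j
    | inr (inl j) => r^-1 * p ord0 j
    | inr (inr j) => r^-1 * q ord0 j end.
  have gn : \sum_(k : 'I_n + 'I_n) g (inr k) ^+ 2 = 1.
    rewrite big_sumType /=.
    under eq_bigr do rewrite exprMn.
    under [X in _ + X]eq_bigr do rewrite exprMn.
    by rewrite -!mulr_sumr -mulrDr -/s exprVn r2 mulVf // gt_eqF.
  exists g.
    move=> [[i j]|k]; rewrite /side /= in_itv /=.
      rewrite A0 /= -(A1 i) (bigD1 j) //= lerDl.
      by apply: sumr_ge0 => k _.
    rewrite -ler_norml -sqrtr_sqr -[leRHS]sqrtr1; apply: ler_wsqrtr.
    rewrite -gn (bigD1 k) //= lerDl.
    by apply: sumr_ge0 => ? _; exact: sqr_ge0.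
  apply/defect_eq0; split=> //.
  have -> : mxpart g = A by apply/matrixP => i j; rewrite !mxE.
  have -> : repart g = r^-1 *: p by apply/rowP => i; rewrite !mxE.
  have -> : impart g = r^-1 *: q by apply/rowP => i; rewrite !mxE.
  rewrite /eigenpair -!scalemxAl pA qA scalerBr scalerDr !scalerA.
  by rewrite ![_ * r^-1]mulrC.
apply/ThetaP; exists (mxpart g), (repart g), (impart g); split=> //.
  split=> [i j|i]; first by rewrite mxE; have /= := bg (inl (i, j));
    rewrite in_itv => /andP[].
  by rewrite -[RHS](s1 i); apply: eq_bigr => j _; rewrite mxE.
rewrite -negb_and; apply/negP => /andP[/eqP/rowP p0 /eqP/rowP q0].
move/eqP: s2; rewrite big_sumType /= !big1 ?addr0 1?eq_sym ?oner_eq0 // => j _.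
  by move: (q0 j); rewrite !mxE => ->; rewrite expr0n.
by move: (p0 j); rewrite !mxE => ->; rewrite expr0n.
Qed.

(** The image of the box under [defect a b] is compact, hence closed. Elements of [Theta R n] close
    to a + i b give values close to 0 in this image, so 0 is attained. *)
Lemma Theta_closed : closed (Theta R n).
Proof.
move=> [a b] cl; apply/defectP.
have /(_ 0)[]: closed (defect a b @` box).
- apply: compact_closed; first exact: norm_hausdorff.
  apply: continuous_compact; last exact: box_compact.
  exact/continuous_subspaceT/defect_continuous.
- move=> B /nbhs_ballP[e /= e0 eB].
  have [x [y [/defectP[g bg g0] xy]]] := closure_Theta cl e0.
  exists (defect a b g); split; first by exists g.
  apply: eB; rewrite (defect_shift a b g0) /ball /= sub0r normrN ger0_norm //.
  by rewrite addr_ge0 ?sqr_ge0.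
- by move=> g bg g0; exists g.
Qed.

End Closed.

(** * Perturbation at nonreal eigenvalues, and the bound on real ones *)

Section Interior.
Variables (R : realType) (n : nat).
Implicit Types (A : 'M[R]_n) (p q : 'rV[R]_n).

Let one : 'cV[R]_n := const_mx 1.

Lemma stochasticP A :
  stochastic A <-> (forall i j, 0 <= A i j) /\ A *m one = one.
Proof.
have row_sum i : (A *m one) i 0 = \sum_j A i j.
  by rewrite !mxE; apply: eq_bigr => j _; rewrite mxE mulr1.
split=> -[A0 A1]; split=> //; last by move=> i; rewrite -row_sum A1 mxE.
by apply/colP => i; rewrite row_sum A1 mxE.
Qed.

(** Since A fixes [one], the number v [one] equals l (v [one]) with l = a + i b, and l differs from
    1 because b is nonzero. *)
Lemma eigenpair_mul1 A (a b : R) p q : stochastic A -> b != 0 ->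
  eigenpair A a b p q -> p *m one = 0 /\ q *m one = 0.
Proof.
move=> /stochasticP[_ A1] b0 [pA qA].
have: p *m A *m one = p *m one by rewrite -mulmxA A1.
have: q *m A *m one = q *m one by rewrite -mulmxA A1.
rewrite pA qA mulmxBl mulmxDl -!scalemxAl.
rewrite [p *m one]mx11_scalar [q *m one]mx11_scalar.
move: ((p *m one) 0 0) ((q *m one) 0 0) => x y.
move=> /matrixP/(_ 0 0) + /matrixP/(_ 0 0); rewrite !mxE /= !mulr1n => hy hx.
(* This is |1 - l|^2, the determinant of the real 2 x 2 system for x and y; Cramer's rule gives the
   identities below. *)
have d0 : (1 - a) ^+ 2 + b ^+ 2 != 0.
  by rewrite gt_eqF // ltr_wpDl ?sqr_ge0 // lt_def sqrf_eq0 b0 sqr_ge0.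
have x0 : x = 0.
  apply: (mulfI d0); rewrite mulr0.
  have -> : ((1 - a) ^+ 2 + b ^+ 2) * x
    = (1 - a) * (x - (a * x - b * y)) - b * (y - (b * x + a * y)) by ring.
  by rewrite hx hy !subrr !mulr0 subrr.
have y0 : y = 0.
  apply: (mulfI d0); rewrite mulr0.
  have -> : ((1 - a) ^+ 2 + b ^+ 2) * y
    = (1 - a) * (y - (b * x + a * y)) + b * (x - (a * x - b * y)) by ring.
  by rewrite hx hy !subrr !mulr0 addr0.
by rewrite x0 y0 !raddf0.
Qed.

(** Applying A to x p + y q = 0 gives b (y p - x q) = 0. Together the two relations say that (x - i
    y) (p + i q) = 0, so x = y = 0. *)
Lemma eigenpair_row_free A (a b : R) p q : b != 0 ->
  (p != 0) || (q != 0) -> eigenpair A a b p q -> row_free (col_mx p q).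
Proof.
move=> b0 pq0 [pA qA]; apply: inj_row_free => v.
rewrite -[v]hsubmxK mul_row_col [lsubmx v]mx11_scalar [rsubmx v]mx11_scalar.
move: (lsubmx v 0 0) (rsubmx v 0 0) => x y; rewrite !mul_scalar_mx => e1.
have e2 : y *: p - x *: q = 0.
  have: (x *: p + y *: q) *m A = 0 by rewrite e1 mul0mx.
  rewrite mulmxDl -!scalemxAl pA qA => e3.
  apply: (scalerI b0); rewrite scaler0.
  transitivity (x *: (a *: p - b *: q) + y *: (b *: p + a *: q)
                - a *: (x *: p + y *: q)); last by rewrite e1 e3 scaler0 subr0.
  by apply/rowP => j; rewrite !mxE; ring.
have d0 : x ^+ 2 + y ^+ 2 = 0.
  case/orP: pq0 => pq0.
    have: (x ^+ 2 + y ^+ 2) *: p = 0.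
      transitivity (x *: (x *: p + y *: q) + y *: (y *: p - x *: q)).
        by apply/rowP => j; rewrite !mxE; ring.
      by rewrite e1 e2 !scaler0 addr0.
    by move/eqP; rewrite scaler_eq0 (negPf pq0) orbF => /eqP.
  have: (x ^+ 2 + y ^+ 2) *: q = 0.
    transitivity (y *: (x *: p + y *: q) - x *: (y *: p - x *: q)).
      by apply/rowP => j; rewrite !mxE; ring.
    by rewrite e1 e2 !scaler0 subr0.
  by move/eqP; rewrite scaler_eq0 (negPf pq0) orbF => /eqP.
move/eqP: d0; rewrite paddr_eq0 ?sqr_ge0 // !sqrf_eq0 => /andP[/eqP-> /eqP->].
by rewrite raddf0 row_mx0.
Qed.

Lemma Theta_nonreal_interior (a b t : R) : b != 0 -> 0 < t < 1 ->
  Theta R n (a +i* b) -> interior (Theta R n) ((t * a) +i* (t * b)).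
Proof.
move=> b0 /andP[t0 t1] /ThetaP[A [p [q [sA pq0 epq]]]].
have [p1 q1] := eigenpair_mul1 sA b0 epq.
have /row_freeP[N MN] := eigenpair_row_free b0 pq0 epq.
case: epq => pA qA; move/stochasticP: sA => [A0 A1].
have n0 : (0 < n)%N.
  case: (posnP n) pq0 => // n0; suff [-> ->] : p = 0 /\ q = 0 by rewrite eqxx.
  by split; apply/rowP => j; have := ltn_ord j; rewrite [X in (_ < X)%N]n0.
(* [N] is a right inverse of the matrix with rows p and q. So v [E1] = v and v [E2] = i v, where i
   (p + i q) = - q + i p. *)
pose E1 := N *m col_mx p q; pose E2 := N *m col_mx (- q) p.
pose K := 1 + \sum_i \sum_j (`|E1 i j| + `|E2 i j|).
have EK i j : `|E1 i j| + `|E2 i j| <= K.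
  apply: ler_wpDl => //; rewrite (bigD1 i) //= (bigD1 j) //= -addrA lerDl.
  apply: addr_ge0; apply: sumr_ge0 => k _; first exact: addr_ge0.
  by apply: sumr_ge0 => l _; exact: addr_ge0.
have K0 : 0 < K.
  by rewrite ltr_pwDl // sumr_ge0 // => i _; rewrite sumr_ge0 // => j _;
    rewrite addr_ge0.
(* Every entry of (1 - t) J / n is [c], so a perturbation with entries at most [c] in modulus keeps
   B + E nonnegative. The radius [c / K] ensures this, [K] being a positive bound on the entries of
   |E1| + |E2|. *)
pose c := (1 - t) / n%:R.
have c0 : 0 < c by rewrite divr_gt0 ?subr_gt0 ?ltr0n.
apply: (@nbhs_Theta _ _ _ _ (c / K)); first by rewrite divr_gt0.
move=> x y xa yb; pose da := x - t * a; pose db := y - t * b.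
pose E := da *: E1 + db *: E2.
have EF : E = N *m col_mx (da *: p - db *: q) (db *: p + da *: q).
  rewrite /E /E1 /E2 !scalemxAr -mulmxDr !scale_col_mx add_col_mx scalerN.
  by congr (_ *m col_mx _ _); rewrite addrC.
have Ec i j : `|E i j| <= c.
  have -> : E i j = da * E1 i j + db * E2 i j.
    by rewrite [LHS]mxE; congr (_ + _); rewrite [LHS]mxE.
  apply: le_trans (_ : c / K * (`|E1 i j| + `|E2 i j|) <= _); last first.
    by rewrite -[leRHS](divfK (lt0r_neq0 K0)) ler_wpM2l // divr_ge0 ?ltW.
  rewrite mulrDr; apply: le_trans (ler_normD _ _) _; rewrite !normrM.
  by apply: lerD; apply: ler_wpM2r => //; exact: ltW.
have mulE : col_mx p q *m E = col_mx (da *: p - db *: q) (db *: p + da *: q).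
  by rewrite EF mulmxA MN mul1mx.
have [pE qE] : p *m E = da *: p - db *: q /\ q *m E = db *: p + da *: q.
  by move: mulE; rewrite mul_col_mx => /eq_col_mx.
(* The row sums of E are N applied to combinations of p [one] and q [one], both zero. *)
have E0 : E *m one = 0.
  rewrite EF -mulmxA mul_col_mx mulmxBl mulmxDl -!scalemxAl p1 q1.
  by rewrite !scaler0 subrr addr0 col_mx0 mulmx0.
clearbody E.
pose B := t *: A + c *: (one *m one^T) + E.
apply/ThetaP; exists B, p, q; split=> //; last first.
  rewrite /eigenpair /B !mulmxDr -!scalemxAr pE qE pA qA !mulmxA p1 q1.
  rewrite !mul0mx !scaler0 !addr0.
  by split; apply/rowP => j; rewrite !mxE /da /db; ring.
apply/stochasticP; split=> [i j|].
  have -> : B i j = t * A i j + (c + E i j).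
    rewrite [LHS]mxE [X in X + _]mxE addrA; congr (_ + _ + _); first by rewrite mxE.
    by rewrite !mxE big_ord1 !mxE !mulr1.
  rewrite addr_ge0 ?mulr_ge0 ?(ltW t0) //.
  by move: (Ec i j); rewrite ler_norml => /andP[+ _]; rewrite -subr_ge0 opprK addrC.
rewrite /B !mulmxDl -!scalemxAl A1 E0 addr0 -mulmxA.
have -> : one^T *m one = n%:R%:M.
  apply/matrixP => i j; rewrite !ord1 !mxE /= mulr1n.
  by under eq_bigr do rewrite !mxE mulr1; rewrite sumr_const card_ord.
rewrite mul_mx_scalar scalerA divfK ?pnatr_eq0 -?lt0n //.
by rewrite -scalerDl addrC subrK scale1r.
Qed.

(** Right multiplication by a stochastic matrix does not increase the sum of the moduli of a row
    vector. For a real eigenvalue p and q each satisfy the eigenvector equation, and one of them is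
    nonzero. *)
Lemma Theta_real_le1 (a : R) : Theta R n (a +i* 0) -> `|a| <= 1.
Proof.
move=> /ThetaP[A [p [q [[A0 A1] pq0 [pA qA]]]]].
have {pq0 pA qA} [w w0 wA] : exists2 w : 'rV[R]_n, w != 0 & w *m A = a *: w.
  case/orP: pq0 => ?; [exists p | exists q] => //.
    by rewrite pA scale0r subr0.
  by rewrite qA scale0r add0r.
have s0 : 0 < \sum_j `|w 0 j|.
  rewrite lt_def sumr_ge0 ?andbT //.
  apply: contraNN w0 => /eqP /psumr_eq0P s0; apply/eqP/rowP => j.
  by rewrite mxE; apply/eqP; rewrite -normr_eq0; apply/eqP; apply: s0.
rewrite -(ler_pM2r s0) mul1r mulr_sumr.
apply: le_trans (_ : \sum_j \sum_i `|w 0 i| * A i j <= _).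
  apply: ler_sum => j _; rewrite -normrM.
  move/rowP/(_ j): wA; rewrite !mxE => <-.
  apply: le_trans (ler_norm_sum _ _ _) _.
  by apply: ler_sum => i _; rewrite normrM [`|A i j|]ger0_norm.
rewrite exchange_big /=; apply: ler_sum => i _.
by rewrite -mulr_sumr A1 mulr1.
Qed.

End Interior.

(** * Real points, through circulant matrices *)

Lemma Theta_square (R : realType) (n : nat) (a b : R) : (3 < n)%N ->
  `|a| + `|b| <= 1 -> Theta R n (a +i* b).
Proof.
move=> n3 ab; have -> : n = (4 + (n - 4))%N by rewrite subnKC.
move: (n - 4)%N => m {n n3}.
(* [a + i b] is written as the convex combination of 1, i, -1, -i with weights
   [s]; the eigenvector has entries 1, -i, -1, i followed by zeros. *)
pose s := [:: (1 - `|b| + a) / 2; (`|b| + b) / 2;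
              (1 - `|b| - a) / 2; (`|b| - b) / 2].
(* Modulo 4, j + 3 i is j - i, so the leading block is circulant. Further rows repeat the pattern to
   keep row sums 1; the zeros of the eigenvector cancel them, and further columns vanish. *)
pose A : 'M[R]_(4 + m) := \matrix_(i, j)
  if (j < 4)%N then nth 0 s ((j + 3 * i) %% 4) else 0.
pose p : 'rV[R]_(4 + m) := \row_j nth 0 [:: 1; 0; -1; 0] j.
pose q : 'rV[R]_(4 + m) := \row_j nth 0 [:: 0; -1; 0; 1] j.
apply/ThetaP; exists A, p, q; split.
- split=> [i j|i].
    rewrite mxE; case: ifP => // _; apply/(all_nthP 0) => //=; last first.
      by rewrite ltn_pmod.
    have := ler_norm a; have := ler_norm (- a).
    have := ler_norm b; have := ler_norm (- b); rewrite !normrN => *.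
    by apply/and5P; split=> //; lra.
  rewrite big_split_ord /= [X in _ + X]big1 ?addr0; last first.
    by move=> j _; rewrite mxE.
  do 4! rewrite big_ord_recl; rewrite big_ord0 !mxE /=.
  rewrite /bump /=.
  (* The row index matters only modulo 4, which leaves four cases. *)
  have red k : ((k + 3 * i) %% 4 = (k + 3 * (i %% 4)) %% 4)%N.
    by rewrite -modnDmr -modnMmr modnDmr.
  rewrite ![((_ + 3 * i) %% 4)%N]red.
  have: (i %% 4 < 4)%N by rewrite ltn_pmod.
  by case: (i %% 4)%N => [|[|[|[|]]]] //= _; field.
- apply/orP; left; apply/eqP => /rowP/(_ (lshift m ord0)); rewrite !mxE /=.
  by move/eqP; rewrite oner_eq0.
- split; apply/rowP => j; rewrite !mxE big_split_ord /= [X in _ + X]big1 ?addr0.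
  + do 4! rewrite big_ord_recl; rewrite big_ord0 !mxE /=.
    by case: j => [[|[|[|[|j]]]] jm] /=; rewrite ?nth_nil; field.
  + by move=> k _; rewrite !mxE /= nth_nil mul0r.
  + do 4! rewrite big_ord_recl; rewrite big_ord0 !mxE /=.
    by case: j => [[|[|[|[|j]]]] jm] /=; rewrite ?nth_nil; field.
  + by move=> k _; rewrite !mxE /= nth_nil mul0r.
Qed.

Lemma Theta_real_interior (R : realType) (n : nat) (a : R) : (3 < n)%N ->
  `|a| < 1 -> interior (Theta R n) (a +i* 0).
Proof.
(* With this radius, |x| + |y| is less than |a| + 2 (1 - |a|) / 2 = 1. *)
move=> n3 a1; apply: (@nbhs_Theta _ _ _ _ ((1 - `|a|) / 2)).
  by rewrite divr_gt0 // subr_gt0.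
move=> x y; rewrite subr0 => xa y0; apply: Theta_square => //.
have : `|x| <= `|x - a| + `|a| by rewrite -{1}(subrK a x) ler_normD.
by move: xa y0; move: `|x| `|x - a| `|a| `|y| => *; lra.
Qed.

Theorem theorem6p3 (R : realType) (n : nat) (hn : (3 < n)%N) :
  boundary (Theta R n) `<=` extremal R n.
Proof.
move=> [a b] [cl nint]; split; first exact: Theta_closed.
move=> g g1; have g0 : 0 < g by rewrite (lt_trans _ g1).
have -> : g%:C * (a +i* b) = (g * a) +i* (g * b).
  by apply/eqP; rewrite eq_complex /= !mul0r subr0 addr0 !eqxx.
(* If g l were in [Theta R n], then l = g^-1 (g l) with 0 < g^-1 < 1 would be an interior point,
   contrary to l being on the boundary. *)
move=> T; apply: nint.
have [b0|b0] := eqVneq b 0.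
  rewrite b0 in T *; apply: Theta_real_interior => //.
  move: T; rewrite mulr0 => /Theta_real_le1; rewrite normrM (gtr0_norm g0) => ga.
  by rewrite -(ltr_pM2l g0) (le_lt_trans ga) // mulr1.
rewrite -(mulKf (lt0r_neq0 g0) a) -(mulKf (lt0r_neq0 g0) b).
apply: Theta_nonreal_interior => //; first exact: mulf_neq0 (lt0r_neq0 g0) b0.
by rewrite invr_gt0 g0 invf_lt1.
Qed.
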